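(* Let $n \geq 4$. Then the matrix $\mathscr{X} := \mathscr{X}_{S^{(n-1,1)}}\big(\mathsf{i}_y(n) + \mathsf{f}_z(n)\big)$ is diagonalizable, and $$\mathrm{Sp}(\mathscr{X}) = \Big\{(n-2)! \Big(nz - \sum_{1\le i<j\le n} (j-i)y_{i,j}\Big),\ n(n-2)!z\Big\},$$ where the eigenvalue $(n-2)! \big(nz - \sum_{1\le i<j\le n} (j-i)y_{i,j}\big)$ has multiplicity $1$ and the eigenvalue $n(n-2)!z$ has multiplicity $n-2$.
   Context: $[n]=\{1,\dots,n\}$ and $\mathfrak{S}_n$ is the symmetric group of $[n]$. Let $z$ and $y_{i,j}$ ($1 \le i<j \le n$) be independent indeterminates over $\mathbb{R}$, let $P$ be the polynomial ring over $\mathbb{R}$ in these indeterminates, and let $P[\mathfrak{S}_n]$ be the group algebra. For $\sigma\in\mathfrak{S}_n$, $\mathrm{inv}_y(\sigma) := \sum_{i<j,\ \sigma(i)>\sigma(j)} y_{i,j}$ and $\mathrm{fix}_z(\sigma) := \#\{i\in[n]\mid \sigma(i)=i\}\cdot z$. Set $\mathsf{i}_y(n) := \sum_{\sigma \in \mathfrak{S}_n} \mathrm{inv}_y(\sigma)\sigma$ and $\mathsf{f}_z(n) := \sum_{\sigma \in \mathfrak{S}_n} \mathrm{fix}_z(\sigma)\sigma$ in $P[\mathfrak{S}_n]$. $S^{(n-1,1)}$ is the Specht module of the partition $(n-1,1)$, realized as the submodule with basis $\{\mathbf{1}-\mathbf{i}\}_{i\in\{2,\dots,n\}}$ of the permutation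 module with basis $\mathbf{1},\dots,\mathbf{n}$ on which $\sigma\cdot\mathbf{i}=\boldsymbol{\sigma(i)}$ (scalars extended to $P$). $\mathscr{X}_{S^{(n-1,1)}}(a)$ is the $(n-1)\times(n-1)$ matrix of the action of $a\in P[\mathfrak{S}_n]$ on this module in this basis, regarded as a matrix over the field of fractions of $P$. $\mathrm{Sp}(\mathsf{M})$ is the set of eigenvalues of a square matrix $\mathsf{M}$. *)

(* Defs.v *)
From mathcomp Require Import all_boot all_order all_algebra all_fingroup.
From mathcomp Require Import reals mpoly.

Set Implicit Arguments.
Unset Strict Implicit.
Unset Printing Implicit Defensive.
Import GRing.Theory.
Local Open Scope ring_scope.

(* Throughout, [n] = {1, ..., n} is rendered as 'I_n = {0, ..., n - 1}. *)

Definition ipair (n : nat) := {p : 'I_n * 'I_n | (p.1 < p.2)%N}.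

Definition fstp (n : nat) (p : ipair n) : 'I_n := (val p).1.
Definition sndp (n : nat) (p : ipair n) : 'I_n := (val p).2.

(* One indeterminate per element of this type: None stands for z and
   Some (i, j) for y_{i,j}. *)
Definition indet (n : nat) := option (ipair n).

Definition polyring (R : realType) (n : nat) := {mpoly R[#|{: indet n}|]}.

Definition zvar (R : realType) (n : nat) : polyring R n :=
  'X_(enum_rank (None : indet n)).

Definition yvar (R : realType) (n : nat) (p : ipair n) : polyring R n :=
  'X_(enum_rank (Some p : indet n)).

Definition inv_y (R : realType) (n : nat) (s : 'S_n) : polyring R n :=
  \sum_(p : ipair n | (s (sndp p) < s (fstp p))%N) yvar R p.

Definition fix_z (R : realType) (n : nat) (s : 'S_n) : polyring R n :=
  #|[set i : 'I_n | s i == i]|%:R * zvar R n.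

(* The free module on 'S_n underlying the group algebra. The product is not
   needed: only the linear action of an element on a module is used. The ^o
   selects scaling by polyring R n itself rather than by R. *)
Definition group_alg (R : realType) (n : nat) :=
  {ffun 'S_n -> (polyring R n)^o}.

Definition group_elt (R : realType) (n : nat) (s : 'S_n) : group_alg R n :=
  [ffun t => (t == s)%:R].

Definition i_y (R : realType) (n : nat) : group_alg R n :=
  \sum_(s : 'S_n) inv_y R s *: group_elt R s.

Definition f_z (R : realType) (n : nat) : group_alg R n :=
  \sum_(s : 'S_n) fix_z R s *: group_elt R s.

Definition ratfrac (R : realType) (n : nat) := {fraction polyring R n}.

(* Action of a group algebra element on the permutation module, whose elements
   are row vectors: v is sent to v *m perm_action a. The row vector with its
   unique 1 at index i is sent by perm_mx s to the one with its unique 1 at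
   index s i (see perm_mx_delta). *)
Definition perm_action (R : realType) (n : nat) (a : group_alg R n) :
    'M[polyring R n]_n :=
  \sum_(s : 'S_n) (a s : polyring R n) *: perm_mx s.

(* Row i is the vector 1 - (i + 2), for i < n - 1, in 1-based notation. *)
Definition specht_basis (K : pzRingType) (n : nat) : 'M[K]_(n.-1, n) :=
  \matrix_(i < n.-1, j < n) ((j == 0 :> nat)%:R - (j == i.+1 :> nat)%:R).

(* conjmx B f is the matrix in the basis of rows of B of the restriction of f
   to the row space of B (see specht_basis_free and specht_basis_stable).
   It lists the coordinates of images in rows; the transposition gives the usual
   convention, with the coordinates of the image of the j-th basis vector in
   column j (see specht_mxP). *)
Definition specht_mx (R : realType) (n : nat) (a : group_alg R n) :
    'M[ratfrac R n]_n.-1 :=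
  (conjmx (specht_basis (ratfrac R n) n)
          (map_mx (@FracField.tofrac _) (perm_action a)))^T.

Lemma perm_mx_delta (K : pzRingType) (n : nat) (s : 'S_n) (i : 'I_n) :
  delta_mx 0 i *m perm_mx s = delta_mx 0 (s i) :> 'rV[K]_n.
Proof.
rewrite -rowE; apply/rowP=> j; rewrite !mxE eqxx /=.
by rewrite eq_sym.
Qed.

Lemma specht_basis_free (K : fieldType) (n : nat) :
  row_free (specht_basis K n).
Proof.
case: n => [|n]; first by rewrite /row_free -leqn0 rank_leq_row.
apply/row_freeP; exists (\matrix_(j < n.+1, k < n) - (j == k.+1 :> nat)%:R).
apply/matrixP=> i k; rewrite !mxE (bigD1 (lift ord0 i)) //= big1 => [|j ji].
  by rewrite !mxE !lift0 /= eqxx sub0r mulrNN mul1r addr0 eqSS.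
rewrite !mxE; have -> : (j == i.+1 :> nat) = false.
  by apply: contraNF ji => /eqP ji; apply/eqP/val_inj.
rewrite subr0; case: eqP => [->|_]; last by rewrite mul0r.
by rewrite mulrN mulr0 oppr0.
Qed.

Lemma specht_basis_stable (R : realType) (n : nat) (a : group_alg R n) :
  stablemx (specht_basis (ratfrac R n) n)
           (map_mx (@FracField.tofrac _) (perm_action a)).
Proof.
case: n a => [|n] a.
  by rewrite [specht_basis _ _]flatmx0 mul0mx sub0mx.
set B := specht_basis _ _.
pose e (i : 'I_n.+1) : 'rV[ratfrac R n.+1]_n.+1 := delta_mx 0 i.
have rowB i : row i B = e 0 - e (lift 0 i).
  by apply/rowP=> j; rewrite !mxE eqxx.
have eB0 k : (e 0 - e k <= B)%MS.
  case: (unliftP 0 k) => [l ->|->]; last by rewrite subrr sub0mx.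
  by rewrite -rowB row_sub.
have eB i j : (e i - e j <= B)%MS.
  have -> : e i - e j = (e 0 - e j) - (e 0 - e i).
    by rewrite opprB [RHS]addrC addrA subrK.
  by rewrite addmx_sub // eqmx_opp.
apply/row_subP=> i.
rewrite /perm_action raddf_sum row_mul mulmx_sumr summx_sub // => s _.
rewrite /= map_mxZ map_perm_mx -scalemxAr scalemx_sub //.
by rewrite rowB mulmxBl !perm_mx_delta.
Qed.

Lemma specht_mxP (R : realType) (n : nat) (a : group_alg R n) (j : 'I_n.-1) :
  row j (specht_basis (ratfrac R n) n)
    *m map_mx (@FracField.tofrac _) (perm_action a) =
  \sum_(k < n.-1) specht_mx a k j *: row k (specht_basis (ratfrac R n) n).
Proof.
have /mulmxKpV E := specht_basis_stable a.
rewrite -row_mul -[in LHS]E row_mul mulmx_sum_row.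
by apply: eq_bigr => k _; rewrite !mxE.
Qed.

(* Main.v *)
(* With 0-based indices, the (k, l) entry of the action of i_y(n) + f_z(n) on the
   permutation module is a constant, plus [k = l] n (n-2)! z, plus w_k h_l, where
   h_l = l - (n-1)/2 and w_k = (n-2)! (sum_{j>k} y_{k,j} - sum_{i<k} y_{i,k}).
   The coefficient of y_{i,j} counts the s with s(k) = l and s(i) > s(j): half of
   the (n-1)! permutations with s(k) = l if k is neither i nor j (swap i and j),
   l (n-2)! of them if k = i, and (n-1-l) (n-2)! if k = j.
   Constant matrices vanish on the sum-zero vectors spanned by the Specht basis, so
   the matrix is the scalar n (n-2)! z plus a matrix of rank one, whose trace
   sum_k w_k h_k = - (n-2)! sum_{i<j} (j-i) y_{i,j} is nonzero. *)

Require Import Defs.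
From mathcomp Require Import all_boot all_order all_algebra all_fingroup.
From mathcomp Require Import reals mpoly.
From mathcomp Require Import ring zify.

Set Implicit Arguments.
Unset Strict Implicit.
Unset Printing Implicit Defensive.
Import GRing.Theory.
Local Open Scope ring_scope.

(** * Spectrum of a scalar matrix plus a rank-one matrix *)

(* Both sides are the determinant of the block matrix [[t, u], [v, 1]] times t,
   computed by eliminating v with column operations, resp. row operations. *)
Lemma det_scalar_sub_rank1 (K : comNzRingType) (m : nat) (t : K)
    (u : 'cV[K]_m) (v : 'rV[K]_m) :
  \det (t%:M - u *m v) * t = t ^+ m * (t - (v *m u) 0 0).
Proof.
pose M := block_mx t%:M u v 1%:M.
have <- : \det M = \det (t%:M - u *m v).
  have E : M *m block_mx 1%:M 0 (- v) 1%:M =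
      block_mx (t%:M - u *m v) u 0 1%:M.
    by rewrite mulmx_block !mulmx1 !mulmx0 mul1mx !add0r mulmxN addrN.
  by move: (congr1 determinant E);
     rewrite det_mulmx det_lblock det_ublock !det1 !mulr1.
have E : block_mx 1%:M 0 (- v) t%:M *m M =
    block_mx t%:M u 0 (t%:M - v *m u).
  rewrite mulmx_block !mul1mx !mul0mx !addr0 mulmx1 mul_mx_scalar scalerN.
  by rewrite mul_scalar_mx addNr mulNmx [_ + t%:M]addrC.
move: (congr1 determinant E).
rewrite det_mulmx det_lblock det_ublock det1 mul1r !det_scalar expr1 mulrC.
by move=> ->; congr (_ * _); rewrite det_mx11 !mxE eqxx.
Qed.

(** The determinant identity is applied over [{poly K}] with [t = 'X - c%:P], a nonzero factor that
    can be cancelled. *)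
Lemma char_poly_scalar_add_rank1 (K : fieldType) (m : nat) (c : K)
    (u : 'cV[K]_m.+1) (v : 'rV[K]_m.+1) :
  char_poly (c%:M + u *m v) =
    ('X - c%:P) ^+ m * ('X - (c + (v *m u) 0 0)%:P).
Proof.
have /mulIf := negbT (polyXsubC_eq0 c); apply.
rewrite /char_poly /char_poly_mx map_mxD map_mxM map_scalar_mx /=.
rewrite opprD addrA -raddfB det_scalar_sub_rank1.
rewrite -map_mxM mxE exprSr mulrAC polyCD opprD addrA.
by [].
Qed.

(** With d = v u, the square of u v is d times u v, so ('X - c)('X - (c + d)) annihilates the
    matrix; its roots are distinct because d is nonzero. *)
Lemma diagonalizable_scalar_add_rank1 (K : fieldType) (m : nat) (c : K)
    (u : 'cV[K]_m.+1) (v : 'rV[K]_m.+1) :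
  (v *m u) 0 0 != 0 -> diagonalizable (c%:M + u *m v).
Proof.
move=> d0; set d := (v *m u) 0 0 in d0 *.
apply/diagonalizableP; exists [:: c; c + d].
  by rewrite /= inE andbT -subr_eq0 opprD addNKr oppr_eq0.
rewrite dvd_mxminpoly big_cons big_seq1 rmorphM !rmorphB /=.
rewrite horner_mx_X !horner_mx_C; apply/eqP.
rewrite (_ : c%:M + u *m v - c%:M = u *m v); last by rewrite addrC addKr.
rewrite raddfD opprD addrA (_ : c%:M + u *m v - c%:M = u *m v);
  last by rewrite addrC addKr.
rewrite -[_ * _]/(_ *m _) mulmxBr mulmxA -(mulmxA u) [v *m u]mx11_scalar -/d.
by rewrite mul_mx_scalar mul_mx_scalar -scalemxAl subrr.
Qed.

Lemma spectrum_scalar_add_rank1 (K : fieldType) (m : nat) (a b : K)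
    (u : 'cV[K]_m.+1) (v : 'rV[K]_m.+1) (X : 'M[K]_m.+1) :
  X = b%:M + u *m v -> a = b + (v *m u) 0 0 -> a != b -> (0 < m)%N ->
  [/\ diagonalizable X,
      forall c, eigenvalue X c <-> c = a \/ c = b,
      mup a (char_poly X) = 1%N
    & mup b (char_poly X) = m].
Proof.
(* Positivity of [m] makes [b] a root of the characteristic polynomial. *)
case: m u v X => // m u v X XE aE ab _.
have XP : char_poly X = ('X - b%:P) ^+ m.+1 * ('X - a%:P).
  by rewrite XE char_poly_scalar_add_rank1 -aE.
split.
- rewrite XE; apply: diagonalizable_scalar_add_rank1.
  by move: ab; rewrite aE addrC -subr_eq0 addrK.
- move=> c; rewrite eigenvalue_root_char XP rootM root_XsubC root_exp_XsubC //.
  by split=> [/orP[/eqP|/eqP]|[]->]; rewrite ?eqxx ?orbT //; [right|left].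
- rewrite XP mupMr ?root_exp_XsubC //.
  by rewrite -['X - a%:P]expr1 mup_XsubCX eqxx.
- by rewrite XP mupMl ?root_XsubC 1?eq_sym // mup_XsubCX eqxx.
Qed.

(** * Counting permutations with prescribed values *)

Lemma sum_nat_of_bool (T : finType) (P Q : pred T) :
  (\sum_(x | P x) Q x = #|[pred x | P x && Q x]|)%N.
Proof.
rewrite -sum1_card big_mkcond [RHS]big_mkcond.
by apply: eq_bigr => x _; rewrite inE; case: (P x); case: (Q x).
Qed.

(** Right multiplication by [t] carries the permutations fixing [A] pointwise bijectively onto those
    agreeing with [t] on [A]. *)
Lemma card_perm_agree (T : finType) (A : {set T}) (t : {perm T}) :
  #|[set s : {perm T} | [forall x in A, s x == t x]]| = (#|T| - #|A|)`!.
Proof.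
have <- : #|~: A| = (#|T| - #|A|)%N by rewrite cardsCs setCK.
rewrite -card_perm -[RHS](card_imset _ (mulIg t)); apply: eq_card => s.
rewrite inE; apply/forall_inP/imsetP => [st|[r rA ->] x xA].
  exists (s * t^-1)%g; last by rewrite mulgKV.
  apply/subsetP=> x; rewrite !inE; apply: contra => xA.
  by rewrite permM (eqP (st x xA)) permK.
rewrite permM; suff /eqP-> : r x == x by [].
by apply: contraTT xA => rx; move/subsetP: rA => /(_ x rx); rewrite inE.
Qed.

Lemma card_perm_agree1 (T : finType) (a b : T) :
  #|[set s : {perm T} | s a == b]| = #|T|.-1`!.
Proof.
rewrite -subn1 -(cards1 a) -(card_perm_agree [set a] (tperm a b)).
apply: eq_card => s; rewrite !inE; apply/idP/forall_inP => [/eqP <- x|].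
  by rewrite inE => /eqP->; rewrite tpermL.
by move/(_ a (set11 a)); rewrite tpermL.
Qed.

Lemma card_perm_agree2 (T : finType) (a b c d : T) : a != c ->
  #|[set s : {perm T} | (s a == b) && (s c == d)]| = ((b != d) * #|T|.-2`!)%N.
Proof.
move=> ac; case: (eqVneq b d) => [<-|bd].
  rewrite mul0n; apply/eqP; rewrite cards_eq0; apply/eqP/setP => s.
  rewrite !inE; apply: contraNF ac => /andP[/eqP sa /eqP sc].
  by apply/eqP/(@perm_inj _ s); rewrite sa.
(* The first factor sends a to b, the second sends the image of c to d; the second leaves b alone,
   since b is neither d nor the image of c. *)
pose t := (tperm a b * tperm (tperm a b c) d)%g.
have ta : t a = b.
  rewrite permM tpermL tpermD // ?[d == b]eq_sym //.
  by rewrite -{2}(tpermL a b) (inj_eq perm_inj) eq_sym.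
have tc : t c = d by rewrite permM tpermL.
have c2 : #|[set a; c]| = 2%N by rewrite cards2 ac.
rewrite mul1n -subn2 -{1}c2 -(card_perm_agree [set a; c] t).
apply: eq_card => s; rewrite !inE.
apply/andP/forall_inP => [[/eqP sa /eqP sc] x|st].
  by rewrite !inE => /orP[] /eqP->; rewrite ?ta ?tc ?sa ?sc.
by rewrite -ta -tc !st // !inE eqxx ?orbT.
Qed.

(** The permutations are partitioned by the value d = s(c). *)
Lemma card_perm_agree_pred (T : finType) (a b c : T) (P : pred T) : a != c ->
  #|[set s : {perm T} | (s a == b) && P (s c)]| =
    (#|[pred d | P d && (b != d)]| * #|T|.-2`!)%N.
Proof.
move=> ac; rewrite -sum1_card.
rewrite (partition_big (fun s : {perm T} => s c) P) => [|s] /=; last first.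
  by rewrite inE => /andP[].
transitivity (\sum_(d | P d) (b != d) * #|T|.-2`!)%N.
  apply: eq_bigr => d Pd; rewrite -(card_perm_agree2 b d ac) -sum1_card.
  apply: eq_bigl => s; rewrite !inE -andbA; congr (_ && _).
  by case: (s c =P d) => [->|_]; rewrite ?Pd ?andbF.
by rewrite -big_distrl sum_nat_of_bool.
Qed.

(** * Inversions and fixed points among the permutations sending k to l *)

(** For i < j this is the coefficient of $y_{i,j}$ in the (k, l) entry. The order of i and j is left
    free so that the two can be exchanged. *)
Definition inversion_count (n : nat) (i j k l : 'I_n) : nat :=
  #|[set s : 'S_n | (s k == l) && (s j < s i)%N]|.

(** Once s(i) = l, the value s(j) is one of the l indices below l, and each choice leaves (n-2)!
    permutations. *)
Lemma inversion_count_fst (n : nat) (i j l : 'I_n) : i != j ->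
  inversion_count i j i l = (l * n.-2`!)%N.
Proof.
move=> ij; have := card_perm_agree_pred l (fun d : 'I_n => d < l)%N ij.
rewrite card_ord => E.
transitivity (#|[pred d : 'I_n | (d < l)%N && (l != d)]| * n.-2`!)%N.
  rewrite -E; apply: eq_card => s; rewrite !inE.
  by case: eqP => // ->.
congr (_ * _)%N; rewrite -[RHS]card_ord -!sum1_card.
rewrite (big_ord_widen n (fun=> 1%N) (ltnW (ltn_ord l))).
apply: eq_bigl => d; rewrite inE andbC; case: eqP => [->|] //=.
by rewrite ltnn.
Qed.

Lemma inversion_countC (n : nat) (i j k l : 'I_n) : i != j ->
  (inversion_count i j k l + inversion_count j i k l)%N = n.-1`!.
Proof.
move=> ij; have := card_perm_agree1 k l; rewrite card_ord => <-.
rewrite -(cardsID [set s : 'S_n | (s j < s i)%N]); congr (_ + _)%N.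
  by apply: eq_card => s; rewrite !inE.
apply: eq_card => s; rewrite !inE andbC -leqNgt ltn_neqAle; congr (_ && _).
by rewrite (inj_eq val_inj) (inj_eq perm_inj) ij.
Qed.

(* Precomposing with the transposition (i j) exchanges the two counts. *)
Lemma inversion_count_off (n : nat) (i j k l : 'I_n) : k != i -> k != j ->
  inversion_count i j k l = inversion_count j i k l.
Proof.
move=> ki kj; rewrite /inversion_count -(card_imset _ (mulgI (tperm i j))).
apply: eq_card => s; apply/imsetP/idP => [[r + ->]|]; rewrite !inE.
  by rewrite !permM tpermL tpermR tpermD // eq_sym.
move=> sP; exists (tperm i j * s)%g; last by rewrite mulgA tperm2 mul1g.
by rewrite inE !permM tpermL tpermR tpermD // eq_sym.
Qed.

(** One formula covers k = i, k = j (the complementary count) and k off the pair (equal counts);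
    doubling avoids halves. *)
Lemma inversion_countE (K : comNzRingType) (n : nat) (i j k l : 'I_n) : i != j ->
  (inversion_count i j k l)%:R * 2 =
    n.-1`!%:R + ((k == i)%:R - (k == j)%:R) * n.-2`!%:R * (2 * l%:R - n.-1%:R) :> K.
Proof.
(* Two distinct indices force n > 1, without which (n-1)! = (n-1) (n-2)! fails for the truncated
   predecessors. *)
move=> ij; have n1 : (1 < n)%N.
  apply: contraNT ij => n1; apply/eqP/val_inj => /=.
  by have := ltn_ord i; have := ltn_ord j; lia.
have f1 : n.-1`!%:R = n.-1%:R * n.-2`!%:R :> K.
  by rewrite -natrM; case: n n1 {i j k l ij} => [|[]].
have E := congr1 (fun x : nat => x%:R : K) (inversion_countC k l ij).
rewrite natrD in E.
move: E; have [->|ki] := eqVneq k i => [_|].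
  by rewrite (negPf ij) inversion_count_fst // natrM f1 /=; ring.
have [->|kj] := eqVneq k j.
  rewrite [inversion_count j i _ _]inversion_count_fst 1?eq_sym // natrM.
  by move/(canRL (addrK _)) ->; rewrite f1 /=; ring.
by move <-; rewrite -inversion_count_off //=; ring.
Qed.

(** Pairs (s, i) with s(k) = l and s(i) = i are counted by i: i = k gives (n-1)! if k = l and 0
    otherwise, while any other i gives (n-2)! unless i = l. *)
Lemma sum_card_fixed (n : nat) (k l : 'I_n) :
  (\sum_(s : 'S_n | s k == l) #|[set i | s i == i]| =
    n.-2 * n.-2`! + (k == l) * (n * n.-2`!))%N.
Proof.
transitivity (\sum_i #|[set s : 'S_n | (s k == l) && (s i == i)]|)%N.
  under [RHS]eq_bigr => i _ do
    rewrite cardsE -(sum_nat_of_bool (fun s : 'S_n => s k == l) (fun s => s i == i)).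
  rewrite [RHS]exchange_big; apply: eq_bigr => s _.
  by rewrite sum_nat_of_bool cardsE.
rewrite (bigD1 k) //=.
under eq_bigr => i ik do rewrite card_perm_agree2 1?eq_sym // card_ord.
rewrite -big_distrl /= sum_nat_of_bool.
have [<-|kl] := eqVneq k l.
  have -> : [set s : 'S_n | (s k == k) && (s k == k)] = [set s : 'S_n | s k == k].
    by apply/setP => s; rewrite !inE andbb.
  rewrite card_perm_agree1 card_ord.
  have -> : #|[pred x | x != k & x != k]| = n.-1.
    rewrite -[n in n.-1]card_ord [in RHS](cardD1 k) inE /=; apply: eq_card => i.
    by rewrite !inE andbb andbT.
  by case: n k {l} => [[]//|[|n] _] /=; rewrite ?factS; nia.
have -> : [set s : 'S_n | (s k == l) && (s k == k)] = set0.
  by apply/setP => s; rewrite !inE; case: eqP => // ->; rewrite eq_sym (negPf kl).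
rewrite cards0 add0n addn0; congr (_ * _)%N.
rewrite -[n in n.-2]card_ord [in RHS](cardD1 k) [in RHS](cardD1 l) !inE eq_sym kl /=.
by apply: eq_card => i; rewrite !inE andbT andbC.
Qed.

(** * Sum-zero vectors and restriction to the Specht basis *)

Lemma sum_double_ord_sub_pred (K : comNzRingType) (n : nat) :
  \sum_(j < n) (2 * j%:R - n.-1%:R) = 0 :> K.
Proof.
have gauss m : \sum_(j < m) 2 * j%:R = (m * m.-1)%:R :> K.
  elim: m => [|m IHm]; first by rewrite big_ord0.
  rewrite big_ord_recr /= IHm -natrM -natrD; congr _%:R.
  by case: m {IHm} => [|m] /=; lia.
by rewrite big_split /= gauss sumr_const card_ord mulNrn natrM mulr_natl subrr.
Qed.

Lemma specht_basis_mul_const (K : pzRingType) (n p : nat) (x : K) :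
  specht_basis K n *m const_mx x = 0 :> 'M_(n.-1, p).
Proof.
apply/matrixP=> i j; rewrite !mxE.
under eq_bigr => k _ do rewrite !mxE.
case: n i => [[]|n] // i; rewrite big_ord_recl /= subr0 mul1r.
rewrite (bigD1 i) //= big1 => [|k ki].
  by rewrite /bump /= eqxx addr0 sub0r mulN1r subrr.
rewrite /bump /= !add1n eqSS (_ : (k == i :> nat) = false) ?subr0 ?mul0r //.
exact: negPf ki.
Qed.

Lemma sum0_sub_specht_basis (K : fieldType) (n : nat) (h : 'rV[K]_n) :
  \sum_j h 0 j = 0 -> (h <= specht_basis K n)%MS.
Proof.
case: n h => [|n] h h0; first by rewrite [h]thinmx0 sub0mx.
(* Coordinate l + 1 of [h] comes only from basis row l, where the entry is -1; the zero sum then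
   settles coordinate 0. *)
suff -> : h = (\row_i - h 0 (lift 0 i)) *m specht_basis K n.+1 by exact: submxMl.
apply/rowP=> j; rewrite mxE; under eq_bigr => k _ do rewrite !mxE.
case: (unliftP 0 j) => [l ->|->].
  rewrite (bigD1 l) //= big1 => [|k kl].
    by rewrite /bump /= eqxx sub0r mulrN1 opprK addr0.
  rewrite /bump /= !add1n eqSS (_ : (l == k :> nat) = false) ?subr0 ?mulr0 //.
  by rewrite eq_sym; apply: negPf kl.
rewrite big_ord_recl in h0.
under eq_bigr => k _ do rewrite /= subr0 mulr1.
by rewrite sumrN; apply/eqP; rewrite -addr_eq0 h0.
Qed.

(** Writing B for the basis, B kills the constant part and h = v B, so B A = (c + B w v) B; B is
    then cancelled because its rows are free. *)
Lemma conjmx_specht_basis (K : fieldType) (n : nat) (A : 'M[K]_n) (c x : K)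
    (w : 'cV[K]_n) (h : 'rV[K]_n) :
  A = c%:M + const_mx x + w *m h -> \sum_j h 0 j = 0 ->
  exists2 v : 'rV_n.-1, h = v *m specht_basis K n
    & conjmx (specht_basis K n) A = c%:M + (specht_basis K n *m w) *m v.
Proof.
move=> -> /sum0_sub_specht_basis /submxP[v hv]; exists v => //.
rewrite /conjmx -[RHS](mulmxKp (specht_basis_free K n)); congr (_ *m _).
rewrite !mulmxDr specht_basis_mul_const addr0 hv !mulmxA.
by rewrite mul_mx_scalar -mul_scalar_mx -mulmxDl.
Qed.

(** * Entries of the action on the permutation module *)

Lemma group_alg_sumE (R : realType) (n : nat) (g : 'S_n -> polyring R n) s :
  (\sum_(t : 'S_n) g t *: group_elt R t : group_alg R n) s = g s.
Proof.
rewrite sum_ffunE (bigD1 s) //= big1 => [|t ts].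
  by rewrite !ffunE eqxx addr0 -[RHS]mulr1.
by rewrite !ffunE eq_sym (negPf ts) scaler0.
Qed.

(* The qualified name is needed: action.v also exports a perm_action. *)
Lemma perm_actionE (R : realType) (n : nat) (a : group_alg R n) k l :
  Defs.perm_action a k l = \sum_(s : 'S_n | s k == l) (a s : polyring R n).
Proof.
rewrite /Defs.perm_action summxE [RHS]big_mkcond; apply: eq_bigr => s _.
by rewrite !mxE; case: eqP => _; rewrite ?mulr1 ?mulr0.
Qed.

(** This is $w_k$: the signed indicator keeps the pairs starting at k with sign + and those ending
    at k with sign -. *)
Definition slope (R : realType) (n : nat) (k : 'I_n) : polyring R n :=
  n.-2`!%:R * \sum_(p : ipair n) ((k == fstp p)%:R - (k == sndp p)%:R) * yvar R p.

Lemma sum_inv_y (R : realType) (n : nat) (k l : 'I_n) :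
  2 * \sum_(s : 'S_n | s k == l) inv_y R s =
    n.-1`!%:R * (\sum_(p : ipair n) yvar R p) + slope R k * (2 * l%:R - n.-1%:R).
Proof.
have -> : \sum_(s : 'S_n | s k == l) inv_y R s =
    \sum_(p : ipair n) (inversion_count (fstp p) (sndp p) k l)%:R * yvar R p.
  rewrite /inv_y; under eq_bigr do rewrite big_mkcond.
  rewrite exchange_big; apply: eq_bigr => p _.
  by rewrite -big_mkcondr sumr_const mulr_natl /inversion_count cardsE.
rewrite /slope !(mulr_sumr, mulr_suml) -big_split; apply: eq_bigr => p _ /=.
have fs : fstp p != sndp p by rewrite -(inj_eq val_inj) ltn_eqF // (valP p).
by rewrite mulrA [2 * _]mulrC inversion_countE //; ring.
Qed.

Lemma sum_fix_z (R : realType) (n : nat) (k l : 'I_n) :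
  \sum_(s : 'S_n | s k == l) fix_z R s =
    (n.-2 * n.-2`! + (k == l) * (n * n.-2`!))%:R * zvar R n.
Proof. by rewrite -sum_card_fixed natr_sum mulr_suml. Qed.

(** Each $y_{i,j}$ occurs in the slope at i with sign + and in the slope at j with sign -. This
    evaluates the trace of the rank-one part. *)
Lemma sum_slope (R : realType) (n : nat) (g : 'I_n -> polyring R n) :
  \sum_k slope R k * g k =
    n.-2`!%:R * \sum_(p : ipair n) (g (fstp p) - g (sndp p)) * yvar R p.
Proof.
rewrite /slope; under eq_bigr => k _ do rewrite -mulrA mulr_suml.
rewrite -mulr_sumr exchange_big; congr (_ * _); apply: eq_bigr => p _.
under eq_bigr => k _ do rewrite mulrAC mulrBl.
rewrite -mulr_suml sumrB; congr ((_ - _) * _).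
  rewrite (bigD1 (fstp p)) //= big1 => [|k /negPf->]; last by rewrite mul0r.
  by rewrite eqxx mul1r addr0.
rewrite (bigD1 (sndp p)) //= big1 => [|k /negPf->]; last by rewrite mul0r.
by rewrite eqxx mul1r addr0.
Qed.

Lemma polyring_natr_eq0 (R : realType) (n m : nat) :
  (m%:R == 0 :> polyring R n) = (m == 0%N).
Proof. by rewrite -mpolyC_nat mpolyC_eq0 Num.Theory.pnatr_eq0. Qed.

(** Setting every indeterminate to 1 leaves a sum of natural numbers to which the pair (0, 1)
    contributes 1. *)
Lemma sum_width_yvar_neq0 (R : realType) (n : nat) : (1 < n)%N ->
  \sum_(p : ipair n) (sndp p - fstp p)%N%:R * yvar R p != 0.
Proof.
move=> n1; apply/eqP => /(congr1 (meval (fun=> 1))) /eqP.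
rewrite meval0 raddf_sum /=.
under eq_bigr => p _ do rewrite mevalM mevalXU mulr1 -mpolyC_nat mevalC.
rewrite -natr_sum Num.Theory.pnatr_eq0 sum_nat_eq0 => /forallP.
pose p : 'I_n * 'I_n := (Ordinal (ltnW n1), Ordinal n1).
by move/(_ (exist (fun q : 'I_n * 'I_n => (q.1 < q.2)%N) p isT)).
Qed.

(** The first two terms do not depend on k and l, the third is a product of a function of k and a
    function of l, and the last is scalar. *)
Lemma perm_action_entry (R : realType) (n : nat) (k l : 'I_n) :
  2 * Defs.perm_action (i_y R n + f_z R n) k l =
    n.-1`!%:R * (\sum_(p : ipair n) yvar R p)
      + 2 * (n.-2 * n.-2`!)%:R * zvar R n
    + slope R k * (2 * l%:R - n.-1%:R)
    + 2 * ((n%:R * n.-2`!%:R * zvar R n) *+ (k == l)).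
Proof.
have coefE s : (i_y R n + f_z R n) s = inv_y R s + fix_z R s.
  by rewrite ffunE !group_alg_sumE.
rewrite perm_actionE; under eq_bigr => s _ do rewrite coefE.
rewrite big_split /= mulrDr sum_inv_y sum_fix_z natrD !natrM.
by case: eqP => _ /=; ring.
Qed.

(** * The Specht matrix over the fraction field and its spectrum *)

Lemma rmorph_halve (A : comNzRingType) (K : fieldType) (f : {rmorphism A -> K})
    (a c s t x : A) : 2 != 0 :> K ->
  2 * a = x + s * t + 2 * c -> f a = f c + 2^-1 * f x + 2^-1 * f s * f t.
Proof.
move=> K2 /(congr1 f); rewrite !(rmorphD, rmorphM, rmorph_nat) => E.
by apply: (mulfI K2); rewrite E; field.
Qed.

Lemma specht_mx_rank1 (R : realType) (n : nat) :
  let d : polyring R n :=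
    - (n.-2`!%:R * \sum_(p : ipair n) (sndp p - fstp p)%N%:R * yvar R p) in
  exists (u : 'cV[ratfrac R n]_n.-1) (v : 'rV[ratfrac R n]_n.-1),
    specht_mx (i_y R n + f_z R n) =
      (FracField.tofrac (n%:R * n.-2`!%:R * zvar R n))%:M + u *m v
    /\ (v *m u) 0 0 = FracField.tofrac d.
Proof.
move=> d.
have F2 : 2 != 0 :> ratfrac R n.
  rewrite -(rmorph_nat (@FracField.tofrac (polyring R n))) tofrac_eq0.
  by rewrite polyring_natr_eq0.
(* Here [h] is twice the vector $h_l$; the factor 1/2 in [w] compensates. *)
pose w : 'cV[ratfrac R n]_n := \col_k (2^-1 * FracField.tofrac (slope R k)).
pose h : 'rV[ratfrac R n]_n := \row_l FracField.tofrac (2 * l%:R - n.-1%:R).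
pose x := 2^-1 * FracField.tofrac (n.-1`!%:R * (\sum_(p : ipair n) yvar R p)
  + 2 * (n.-2 * n.-2`!)%:R * zvar R n).
have h0 : \sum_j h 0 j = 0.
  under eq_bigr => j _ do rewrite mxE.
  by rewrite -rmorph_sum sum_double_ord_sub_pred rmorph0.
have E : map_mx (@FracField.tofrac _) (Defs.perm_action (i_y R n + f_z R n)) =
    (FracField.tofrac (n%:R * n.-2`!%:R * zvar R n))%:M + const_mx x + w *m h.
  apply/matrixP => k l.
  rewrite !mxE big_ord1 !mxE -rmorphMn /x.
  exact: rmorph_halve F2 (perm_action_entry R k l).
have [v hv Xv] := conjmx_specht_basis E h0.
(* The transposition in [specht_mx] exchanges the roles of the column and row factors. *)
exists v^T, (specht_basis _ n *m w)^T; split.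
  by rewrite /specht_mx Xv linearD /= tr_scalar_mx trmx_mul.
(* The trace v (B w) equals h w, a sum over the permutation basis. *)
rewrite -trmx_mul mulmxA -hv !mxE; apply: (mulfI F2).
transitivity (FracField.tofrac (\sum_(k < n) slope R k * (2 * k%:R - n.-1%:R))).
  rewrite [RHS]raddf_sum mulr_sumr; apply: eq_bigr => k _.
  by rewrite !mxE [LHS]mulrCA (mulVKf F2) mulrC -rmorphM.
(* For g(k) = 2k - (n-1), the difference g(i) - g(j) is -2 (j - i). *)
rewrite sum_slope -(rmorph_nat (@FracField.tofrac _)) -rmorphM.
congr (FracField.tofrac _).
rewrite /d mulrN mulrCA -mulrN; congr (_ * _).
rewrite mulr_sumr -sumrN; apply: eq_bigr => p _.
by rewrite natrB ?(ltnW (valP p)) //; ring.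
Qed.

Theorem theorem1p5 (R : realType) (n : nat) (hn : (4 <= n)%N) :
  let X := specht_mx (i_y R n + f_z R n) in
  let z := zvar R n in
  let lam1 : ratfrac R n := FracField.tofrac
    ((n - 2)`!%N%:R
      * (n%:R * z - \sum_(p : ipair n) (sndp p - fstp p)%N%:R * yvar R p)) in
  let lam2 : ratfrac R n := FracField.tofrac (n%:R * (n - 2)`!%N%:R * z) in
  [/\ diagonalizable X,
      forall a : ratfrac R n, eigenvalue X a <-> a = lam1 \/ a = lam2,
      mup lam1 (char_poly X) = 1%N
    & mup lam2 (char_poly X) = (n - 2)%N].
Proof.
(* With n = m + 2 the matrix has size m + 1, and m = n - 2 is the larger multiplicity. *)
case: n hn => [|[|m]] // hn; rewrite subn2 -[m.+2.-2]/m => X z lam1 lam2.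
have [u [v []]] := specht_mx_rank1 R m.+2.
set d := - _; rewrite /= -/X -/z -/lam2 => XE vu.
(* The trace [d] is the difference of the two eigenvalues, so its being nonzero separates them. *)
have d0 : FracField.tofrac d != 0.
  rewrite tofrac_eq0 oppr_eq0 mulf_neq0 ?sum_width_yvar_neq0 //.
  by rewrite polyring_natr_eq0 -lt0n fact_gt0.
have lam1E : lam1 = lam2 + (v *m u) 0 0.
  by rewrite vu -rmorphD; congr FracField.tofrac; rewrite /d; ring.
have lam12 : lam1 != lam2 by rewrite lam1E addrC -subr_eq0 addrK vu.
have m0 : (0 < m)%N by case: (m) hn.
clearbody X lam1 lam2.
exact: spectrum_scalar_add_rank1 XE lam1E lam12 m0.
Qed.
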